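(* Let $V$ be an additive abelian group, $v_0\in V$, $\underline{D}=(\mathrm{Id}_V,D_1,D_2,\dots)$ a sequence of elements of $\mathrm{End}(V)$ satisfying $D_m(v_0)=0$ for $m\ge 1$, and $Y:V\to\mathcal{F}(V)$, $u\mapsto Y(u,z):=\sum_n u(n)z^{-n-1}$, a morphism of abelian groups. Suppose that for all $u,v\in V$: (i) $Y(u,z)\sim Y(v,z)$; (ii) $Y(u,z)v_0\in u+zV[[z]]$; (iii) $[D_m,Y(u,z)]=\sum_{i=1}^m\delta_z^{(i)}Y(u,z)\,D_{m-i}$ for all $m\ge 0$. Then $V$, with the products $u(n)v$, is a vertex ring with state-field correspondence $Y$, vacuum vector $v_0$, and canonical Hasse--Schmidt derivation $\underline{D}$.
   Context: $\mathrm{End}(V)$ is the ring of additive endomorphisms of $V$. $\mathcal{F}(V)$ (fields on $V$) is the group of series $a(z)=\sum_{n\in\mathbf{Z}}a(n)z^{-n-1}\in\mathrm{End}(V)[[z,z^{-1}]]$ such that for every $b\in V$, $a(n)b=0$ for all sufficiently large $n$. Write $a(z)\sim b(z)$ (mutually local) if there is an integer $t\ge 0$ with $(z-w)^t[a(z),b(w)]=0$. For $i\ge 0$, $\delta_z^{(i)}a(z):=\sum_n\binom{-n-1}{i}a(n)z^{-n-i-1}$ (the formal ''$\frac1{i!}\partial_z^i$''). Here $\binom{m}{n}=m(m-1)\cdots(m-n+1)/n!$ for $m\in\mathbf{Z}$, $n\ge 1$, and $\binom{m}{0}=1$. A vertex ring is an additive abelian group $V$ with biadditive products $u(n)v$ for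 all $n\in\mathbf{Z}$ and a distinguished element $\mathbf{1}\in V$ (the vacuum) such that for all $u,v,w\in V$: (a) there is an integer $n_0(u,v)\ge 0$ with $u(n)v=0$ for all $n\ge n_0$; (b) $u(-1)\mathbf{1}=u$ and $u(n)\mathbf{1}=0$ for $n\ge 0$; (c) for all $r,s,t\in\mathbf{Z}$, $\sum_{i\ge 0}\binom{r}{i}(u(t+i)v)(r+s-i)w=\sum_{i\ge 0}(-1)^i\binom{t}{i}\{u(r+t-i)v(s+i)w-(-1)^t v(s+t-i)u(r+i)w\}$. Its state-field correspondence is $u\mapsto Y(u,z)=\sum_n u(n)z^{-n-1}$, and its canonical Hasse--Schmidt derivation is the sequence of endomorphisms $u\mapsto u(-m-1)\mathbf{1}$, $m\ge 0$. *)

(* Defs.v *)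
From HB Require Import structures.
From mathcomp Require Import all_boot all_order all_algebra.

Set Implicit Arguments.
Unset Strict Implicit.
Unset Printing Implicit Defensive.

Import Order.TTheory GRing.Theory Num.Theory.
Local Open Scope ring_scope.

(* The division is exact, see [binz_fact] below. *)
Definition binz (m : int) (n : nat) : int :=
  ((\prod_(i < n) (m - i%:Z)) %/ (n`!)%:Z)%Z.

Lemma binz_fact (m : int) (n : nat) :
  binz m n * (n`!)%:Z = \prod_(i < n) (m - i%:Z).
Proof.
rewrite /binz divzK //; case: m => k.
  have -> : \prod_(i < n) (k%:Z - i%:Z) = (k ^_ n)%:Z.
    elim: n => [|n IHn]; first by rewrite big_ord0.
    rewrite big_ord_recr /= IHn ffactnSr PoszM.
    case: (leqP n k) => [le_nk|lt_kn]; first by rewrite subzn.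
    by rewrite ffact_small // !mul0r.
  by rewrite -bin_ffact PoszM dvdz_mull.
have -> : \prod_(i < n) (Negz k - i%:Z) = (-1) ^+ n * ((k + n) ^_ n)%:Z.
  elim: n => [|n IHn]; first by rewrite big_ord0 addn0 ffactn0 mulr1.
  rewrite big_ord_recr /= IHn addnS ffactSS PoszM exprS NegzE.
  rewrite (_ : - k.+1%:Z - n%:Z = - (k + n).+1%:Z); last first.
    by rewrite -opprD -PoszD addSn.
  by rewrite mulrN mulN1r !mulNr mulrC mulrCA.
by rewrite -bin_ffact PoszM mulrA dvdz_mull.
Qed.

(* A one-variable series is encoded by a(z) = \sum_n a(n) z^{-n-1}, a      *)
(* two-variable one by c(z, w) = \sum_(m, n) c(m, n) z^{-m-1} w^{-n-1}.     *)
Record field_on (V : zmodType) := FieldOn {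
  mode :> int -> {additive V -> V};
  mode_field : forall b : V,
    exists N : int, forall n : int, N <= n -> mode n b = 0
}.

Definition series_comm (V : zmodType) (a b : field_on V) :
    int -> int -> V -> V :=
  fun m n x => a m (b n x) - b n (a m x).

(* Multiplication by z - w: multiplying by z moves the coefficient of index *)
(* m + 1 to index m.                                                        *)
Definition mul_zw (V : zmodType) (c : int -> int -> V -> V) :
    int -> int -> V -> V :=
  fun m n x => c (m + 1) n x - c m (n + 1) x.

Definition mutually_local (V : zmodType) (a b : field_on V) : Prop :=
  exists t : nat, forall (m n : int) (x : V),
    iter t (@mul_zw V) (series_comm a b) m n x = 0.

(* The term binz (-k-1) i * a(k) z^{-k-i-1} of \delta^(i) a has index k + i. *)
Definition hasse_deriv (V : zmodType) (i : nat) (a : field_on V) :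
    int -> V -> V :=
  fun n x => let k := n - i%:Z in a k x *~ binz (- k - 1) i.

(* s is the sum over all i >= 0 of a family with finitely many nonzero terms. *)
Definition is_finsum (V : zmodType) (f : nat -> V) (s : V) : Prop :=
  exists2 N : nat, (forall i, (N <= i)%N -> f i = 0) & s = \sum_(i < N) f i.

Record vertex_ring (V : zmodType) := VertexRing {
  vprod : V -> int -> V -> V;
  vacuum : V;
  vprodDl : forall (n : int) (u u' v : V),
    vprod (u + u') n v = vprod u n v + vprod u' n v;
  vprodDr : forall (n : int) (u v v' : V),
    vprod u n (v + v') = vprod u n v + vprod u n v';
  vprod_trunc : forall u v : V,
    exists n0 : nat, forall n : int, n0%:Z <= n -> vprod u n v = 0;
  vprod_vacuumN1 : forall u : V, vprod u (-1) vacuum = u;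
  vprod_vacuum_ge0 : forall (u : V) (n : int), 0 <= n -> vprod u n vacuum = 0;
  vprod_jacobi : forall (u v w : V) (r s t : int),
    exists2 x : V,
      is_finsum (fun i : nat =>
        vprod (vprod u (t + i%:Z) v) (r + s - i%:Z) w *~ binz r i) x
    & is_finsum (fun i : nat =>
        (vprod u (r + t - i%:Z) (vprod v (s + i%:Z) w)
         - vprod v (s + t - i%:Z) (vprod u (r + i%:Z) w) *~ (-1) ^ t)
        *~ ((-1) ^+ i * binz t i)) x
}.

Section StateField.
Variables (V : zmodType) (R : vertex_ring V).

Definition vr_mode (u : V) (n : int) : V -> V := vprod R u n.

Fact vr_mode_nmod_morphism u n : nmod_morphism (vr_mode u n).
Proof.
split; last by move=> x y; apply: vprodDr.
by apply: (@addrI _ (vr_mode u n 0)); rewrite -vprodDr !addr0.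
Qed.

HB.instance Definition _ u n :=
  GRing.isNmodMorphism.Build V V (vr_mode u n) (vr_mode_nmod_morphism u n).

Fact vr_mode_field u (b : V) :
  exists N : int, forall n : int, N <= n -> vr_mode u n b = 0.
Proof. by have [n0 Hn0] := vprod_trunc R u b; exists n0%:Z. Qed.

Definition state_field (u : V) : field_on V :=
  @FieldOn V (fun n => vr_mode u n : {additive V -> V}) (vr_mode_field u).

Definition canonical_hasse (m : nat) (u : V) : V :=
  vprod R u (- m%:Z - 1) (vacuum R).

Fact canonical_hasse_nmod_morphism m : nmod_morphism (canonical_hasse m).
Proof.
split; last by move=> x y; apply: vprodDl.
by apply: (@addrI _ (canonical_hasse m 0)); rewrite -vprodDl !addr0.
Qed.

HB.instance Definition _ m :=
  GRing.isNmodMorphism.Build V V (canonical_hasse m)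
    (canonical_hasse_nmod_morphism m).

End StateField.

(* Main.v *)
Require Import Defs.
From mathcomp Require Import all_boot all_order all_algebra.
From mathcomp Require Import boolp ring zify.

Set Implicit Arguments.
Unset Strict Implicit.
Unset Printing Implicit Defensive.

Import Order.TTheory GRing.Theory Num.Theory.
Local Open Scope ring_scope.

(* Call R(r, s, t) the right-hand side of the Borcherds identity. By locality it
   vanishes for large t, and since z = w + (z - w) it satisfies
   R(r+1, s, t) = R(r, s+1, t) + R(r, s, t+1). The left-hand side obeys the same
   two rules, so descending induction on t reduces the identity to r = 0, which
   says that Y(u(t)v, z) is the t-th residue product of Y(u, z) and Y(v, z).
   Covariance shows that both series agree on v0; by Dong's lemma the residue
   product is local with every Y(x, z), and Goddard's uniqueness theorem
   concludes. No step divides, so everything works over the integers. *)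

(** * Binomial coefficients with integer upper argument *)

Lemma binz0 (m : int) : binz m 0 = 1.
Proof. by have := binz_fact m 0; rewrite big_ord0 mulr1. Qed.

Lemma fact_mulIz (n : nat) : injective (fun x : int => x * (n`!)%:Z).
Proof. by apply: mulIf; rewrite eqz_nat -lt0n fact_gt0. Qed.

Lemma binzSS (m : int) (n : nat) : binz (m + 1) n.+1 = binz m n.+1 + binz m n.
Proof.
apply: (@fact_mulIz n.+1); rewrite mulrDl !binz_fact factS PoszM mulrCA binz_fact.
rewrite big_ord_recl big_ord_recr /= subr0.
under eq_bigr => i _ do rewrite /bump add1n -addn1 PoszD opprD addrA addrAC addrK.
by rewrite intS; ring.
Qed.

Lemma bin0z (n : nat) : binz 0 n.+1 = 0.
Proof.
apply: (@fact_mulIz n.+1); rewrite binz_fact mul0r big_ord_recl subr0.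
exact: mul0r.
Qed.

Lemma binznn (n : nat) : binz n n = 1.
Proof.
apply: (@fact_mulIz n); rewrite binz_fact mul1r.
elim: n => [|n IHn]; first by rewrite big_ord0.
rewrite big_ord_recl subr0 factS PoszM -IHn; congr (_ * _).
by apply: eq_bigr => i _; rewrite lift0; lia.
Qed.

(** Reversing the [n] factors and changing their signs turns one product into the other. This
    converts the coefficients of [hasse_deriv] into those of a binomial expansion. *)
Lemma binz_neg (m : int) (n : nat) :
  binz (n%:Z - m - 1) n = (-1) ^+ n * binz m n.
Proof.
apply: (@fact_mulIz n); rewrite -mulrA !binz_fact.
rewrite -[n in _ ^+ n]card_ord -prodrN (reindex_inj rev_ord_inj) /=.
by apply: eq_bigr => i _; have := ltn_ord i; lia.
Qed.

(** * Sums of eventually zero families *)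

Section FiniteSums.
Variable V : zmodType.
Implicit Types f g : nat -> V.

Definition ev0 f := exists N : nat, forall i, (N <= i)%N -> f i = 0.

(** A total sum, with default value 0 when [f] is not eventually zero; by [sum_ev0] the chosen
    cutoff does not matter. *)
Definition fsum f : V :=
  if pselect (ev0 f) is left f0 then \sum_(i < projT1 (cid f0)) f i else 0.

Lemma sum_ev0 f (N M : nat) :
    (forall i, (N <= i)%N -> f i = 0) -> (forall i, (M <= i)%N -> f i = 0) ->
  \sum_(i < N) f i = \sum_(i < M) f i.
Proof.
wlog le_NM : N M / (N <= M)%N.
  move=> H N0 M0; case/orP: (leq_total N M) => le; first exact: H.
  by rewrite (H M N).
move=> N0 _; rewrite -!(big_mkord xpredT) (big_cat_nat _ le_NM) //=.
by rewrite [X in _ + X]big_nat_cond [X in _ + X]big1 ?addr0 // => i /andP[/andP[/N0]].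
Qed.

Lemma fsumE f (N : nat) :
  (forall i, (N <= i)%N -> f i = 0) -> fsum f = \sum_(i < N) f i.
Proof.
move=> N0; rewrite /fsum; case: pselect => [f0|[]]; last by exists N.
by apply: sum_ev0 => //; case: (cid f0).
Qed.

Lemma fsumP f : ev0 f -> is_finsum f (fsum f).
Proof. by move=> [N N0]; exists N => //; apply: fsumE. Qed.

Lemma is_finsumE f s : is_finsum f s -> fsum f = s.
Proof. by move=> [N N0 ->]; apply: fsumE. Qed.

Lemma is_finsumD f g s s' :
  is_finsum f s -> is_finsum g s' -> is_finsum (fun i => f i + g i) (s + s').
Proof.
move=> [N N0 ->] [M M0 ->]; exists (maxn N M) => [i|].
  by rewrite geq_max => /andP[/N0-> /M0->]; rewrite addr0.
rewrite big_split /= (sum_ev0 (M := maxn N M) N0).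
  by rewrite (sum_ev0 (M := maxn N M) M0) // => i; rewrite geq_max => /andP[_ /M0].
by move=> i; rewrite geq_max => /andP[/N0].
Qed.

Lemma is_finsum_raddf (h : {additive V -> V}) f s :
  is_finsum f s -> is_finsum (h \o f) (h s).
Proof.
move=> [N N0 ->]; exists N; first by move=> i /N0 /= ->; rewrite raddf0.
by rewrite raddf_sum.
Qed.

Lemma is_finsumMz f s k : is_finsum f s -> is_finsum (fun i => f i *~ k) (s *~ k).
Proof.
move=> [N N0 ->]; exists N; first by move=> i /N0 ->; rewrite mul0rz.
exact: mulrz_suml.
Qed.

Lemma is_finsumB f g s s' :
  is_finsum f s -> is_finsum g s' -> is_finsum (fun i => f i - g i) (s - s').
Proof.
move=> Hf /(is_finsumMz (-1)); rewrite mulrN1z => Hg.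
exact: is_finsumD Hf Hg.
Qed.

Lemma is_finsum_head f s :
  is_finsum (f \o S) s -> is_finsum f (f 0%N + s).
Proof.
move=> [N N0 ->]; exists N.+1; first by case=> // i; exact: N0.
by rewrite big_ord_recl.
Qed.

Lemma ev0_behead f : ev0 f -> ev0 (f \o S).
Proof. by move=> [N N0]; exists N => i le_Ni; apply: N0; apply: leqW. Qed.

End FiniteSums.

(** * Binomial expansions of two-variable series *)

(* [binexp eps t G] is the expansion of (z + eps w)^t G(z, w) in nonnegative
   powers of w. *)
Section BinomialExpansion.
Variable V : zmodType.
Implicit Types (G H : int -> int -> V) (eps : int).

Definition binexp_term eps t G r s (i : nat) : V :=
  G (r + t - i%:Z) (s + i%:Z) *~ (eps ^+ i * binz t i).

Definition binexp eps t G r s : V := fsum (binexp_term eps t G r s).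

(** The powers of w are bounded below, uniformly in the power of z, so multiplying by a series in
    nonnegative powers of w gives finite sums. *)
Definition trunc2 G := exists N : int, forall m n, N <= n -> G m n = 0.

Lemma is_finsum_binexp eps t G r s : trunc2 G ->
  is_finsum (binexp_term eps t G r s) (binexp eps t G r s).
Proof.
move=> [N N0]; apply: fsumP; exists `|N - s|%N => i le_i.
by rewrite /binexp_term N0 ?mul0rz //; lia.
Qed.

Lemma binexp_t0 eps G r s : binexp eps 0 G r s = G r s.
Proof.
rewrite /binexp (fsumE (N := 1)) => [|[|i] // _]; last first.
  by rewrite /binexp_term bin0z mulr0 mulr0z.
by rewrite big_ord1 /binexp_term binz0 expr0 subr0 !addr0.
Qed.

(** One factor z + eps w is split off. By Pascal's rule, term [i] of the second expansion joins term
    [i + 1] of the first, whose term 0 stands alone. *)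
Lemma binexpS eps t G r s : trunc2 G ->
  binexp eps (t + 1) G r s
  = binexp eps t G (r + 1) s + binexp eps t G r (s + 1) *~ eps.
Proof.
move=> G0; pose g := binexp_term eps t G (r + 1) s.
have Hg := is_finsum_binexp eps t (r + 1) s G0.
have Hg' : ev0 (g \o S) by apply: ev0_behead; case: Hg => N N0 _; exists N.
have Hr := is_finsumMz eps (is_finsum_binexp eps t r (s + 1) G0).
have Eg : binexp eps t G (r + 1) s = g 0%N + fsum (g \o S).
  exact/is_finsumE/is_finsum_head/fsumP.
rewrite Eg -addrA; apply: is_finsumE.
have <- : binexp_term eps (t + 1) G r s 0 = g 0%N.
  by rewrite /g /binexp_term !binz0; congr (G _ _ *~ _); lia.
apply: is_finsum_head; have := is_finsumD (fsumP Hg') Hr; congr is_finsum.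
apply/funext => i /=; rewrite /g /binexp_term binzSS mulrDr mulrzDr.
congr (G _ _ *~ _ + _); [lia | ].
rewrite -mulrzA exprSr mulrAC; congr (G _ _ *~ _); lia.
Qed.

Lemma binexpB eps t G H r s : trunc2 G -> trunc2 H ->
  binexp eps t (fun m n => G m n - H m n) r s
  = binexp eps t G r s - binexp eps t H r s.
Proof.
move=> G0 H0; apply: is_finsumE.
have := is_finsumB (is_finsum_binexp eps t r s G0) (is_finsum_binexp eps t r s H0).
by congr is_finsum; apply/funext => i; rewrite /binexp_term mulrzBl.
Qed.

Lemma binexp_raddf (h : {additive V -> V}) eps t G r s : trunc2 G ->
  h (binexp eps t G r s) = binexp eps t (fun m n => h (G m n)) r s.
Proof.
move=> G0; apply/esym/is_finsumE.
have := is_finsum_raddf h (is_finsum_binexp eps t r s G0); congr is_finsum.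
by apply/funext => i; rewrite /binexp_term /= raddfMz.
Qed.

Lemma binexp_shift eps t G r s x y :
  binexp eps t (fun m n => G (m + x) (n + y)) r s
  = binexp eps t G (r + x) (s + y).
Proof.
congr fsum; apply/funext => i; rewrite /binexp_term.
by congr (G _ _ *~ _); lia.
Qed.

Lemma binexp0 eps t G r s :
  (forall m n, s <= n -> G m n = 0) -> binexp eps t G r s = 0.
Proof.
move=> G0; rewrite /binexp (fsumE (N := 0)) ?big_ord0 // => i _.
by rewrite /binexp_term G0 ?mul0rz //; lia.
Qed.

End BinomialExpansion.

(** * Residue products *)

Section Residues.
Variable V : zmodType.
Implicit Types a b c : field_on V.

(* Right-hand side of the Borcherds identity; its members with r = 0 are the
   modes of the residue product a_(t) b. *)
Definition resprod a b (t r s : int) (w : V) : V :=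
  binexp (-1) t (fun m n => a m (b n w)) r s
  - binexp (-1) t (fun n m => b n (a m w)) s r *~ (-1) ^ t.

Lemma trunc2_field a (f : int -> V -> V) w :
  (forall m, f m 0 = 0) -> trunc2 (fun m n => f m (a n w)).
Proof.
by move=> f0; have [N N0] := mode_field a w; exists N => m n /N0->; rewrite f0.
Qed.

Lemma trunc2_modes a b w : trunc2 (fun m n => a m (b n w)).
Proof. by apply: (@trunc2_field b (fun m => a m)) => m; rewrite raddf0. Qed.
Hint Resolve trunc2_modes : core.

Lemma signzS (t : int) : (-1) ^ (t + 1) = - (-1) ^ t :> int.
Proof. by rewrite exprzDr // expr1z mulrN1. Qed.

(** The two terms expand the same power of z - w, in nonnegative powers of w and of z respectively;
    raising [t] by one multiplies both by z - w. *)
Lemma resprodS a b t r s w :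
  resprod a b (t + 1) r s w = resprod a b t (r + 1) s w - resprod a b t r (s + 1) w.
Proof.
rewrite /resprod signzS !binexpS // !mulrN1z !mulrNz !mulrzBl.
rewrite ?opprB ?opprK.
by rewrite (AC (2*2) ((1*3)*(4*2))) [RHS](AC (2*2) ((1*3)*(2*4))).
Qed.

Lemma resprod_t0 a b r s w : resprod a b 0 r s w = series_comm a b r s w.
Proof. by rewrite /resprod !binexp_t0. Qed.

(** For a nonnegative exponent the two expansions coincide, leaving (z - w)^t [a(z), b(w)]. *)
Lemma resprod_nat a b (t : nat) r s w :
  resprod a b t r s w = iter t (@mul_zw V) (series_comm a b) r s w.
Proof.
elim: t r s => [|t IHt] r s; first exact: resprod_t0.
by rewrite -addn1 PoszD resprodS !IHt addn1.
Qed.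

Lemma resprod_vanish a b : mutually_local a b ->
  exists t0 : nat, forall t r s w, t0%:Z <= t -> resprod a b t r s w = 0.
Proof.
move=> [t0 ab0]; exists t0 => t r s w le_t.
have -> : t = (t0 + `|t - t0|)%N by lia.
elim: `|_|%N r s => [|k IHk] r s; first by rewrite addn0 resprod_nat.
by rewrite addnS -addn1 PoszD resprodS !IHk subrr.
Qed.

Lemma is_finsum_resprod a b t r s w :
  is_finsum (fun i : nat =>
      (a (r + t - i%:Z) (b (s + i%:Z) w)
       - b (s + t - i%:Z) (a (r + i%:Z) w) *~ (-1) ^ t)
      *~ ((-1) ^+ i * binz t i)) (resprod a b t r s w).
Proof.
have Ha := is_finsum_binexp (-1) t r s (trunc2_modes a b w).
have Hb := is_finsum_binexp (-1) t s r (trunc2_modes b a w).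
have := is_finsumB Ha (is_finsumMz ((-1) ^ t) Hb); congr is_finsum.
by apply/funext => i; rewrite /binexp_term mulrzBl mulrzAC.
Qed.

Lemma resprodx0 a b t r s : resprod a b t r s 0 = 0.
Proof. by rewrite /resprod !binexp0 ?mul0rz ?subrr // => *; rewrite !raddf0. Qed.


(** * Dong's lemma, in three variables *)

(* Multiplication of a series T(z0, z1, z2) by z0 - z1 for (x, y) = (1, 0) and
   by z0 - z2 for (x, y) = (0, 1). *)
Definition mul3 (x y : int) (T : int -> int -> int -> V) :
    int -> int -> int -> V :=
  fun p r s => T (p + 1) r s - T p (r + x) (s + y).

Implicit Types T U : int -> int -> int -> V.

Lemma funext3 T U : (forall p r s, T p r s = U p r s) -> T = U.
Proof. by move=> H; do 3![apply/funext => ?]. Qed.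

Lemma iter_mul3_0 k x y :
  iter k (mul3 x y) (fun _ _ _ => 0) = (fun _ _ _ => 0).
Proof. by elim: k => //= k ->; apply: funext3 => *; rewrite /mul3 subrr. Qed.

Lemma iter_mul3D k x y T U e :
  iter k (mul3 x y) (fun p r s => T p r s + U p r s *~ e)
  = (fun p r s => iter k (mul3 x y) T p r s + iter k (mul3 x y) U p r s *~ e).
Proof.
elim: k => //= k ->; apply: funext3 => p r s.
by rewrite /mul3 mulrzBl opprD addrACA.
Qed.

Lemma mul3C x y x' y' T :
  mul3 x y (mul3 x' y' T) = mul3 x' y' (mul3 x y T).
Proof.
apply: funext3 => p r s; rewrite /mul3 !opprB (addrAC r) (addrAC s).
by rewrite (AC (2*2) ((1*4)*(3*2))).
Qed.

Lemma iter_mul3C k k' x y x' y' T :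
  iter k (mul3 x y) (iter k' (mul3 x' y') T)
  = iter k' (mul3 x' y') (iter k (mul3 x y) T).
Proof.
have C j U : mul3 x y (iter j (mul3 x' y') U) = iter j (mul3 x' y') (mul3 x y U).
  by elim: j => //= j <-; rewrite mul3C.
by elim: k => //= k ->; rewrite C.
Qed.

Lemma iter_mul3_swap k x y T :
  iter k (mul3 x y) (fun p r s => T p s r)
  = (fun p r s => iter k (mul3 y x) T p s r).
Proof. by elim: k => //= k ->. Qed.

Lemma iter_mul3_01 k (h : int -> {additive V -> V}) (X : int -> int -> V -> V) w :
  iter k (mul3 0 1) (fun p r s => h r (X p s w))
  = (fun p r s => h r (iter k (@mul_zw V) X p s w)).
Proof.
elim: k => //= k ->; apply: funext3 => p r s.
by rewrite /mul3 addr0 -raddfB.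
Qed.

Lemma iter_mul3_10 k (X : int -> int -> V -> V) (f : int -> V) :
  iter k (mul3 1 0) (fun p r s => X p r (f s))
  = (fun p r s => iter k (@mul_zw V) X p r (f s)).
Proof. by elim: k => //= k ->; apply: funext3 => p r s; rewrite /mul3 addr0. Qed.

Lemma iter_mul3_param k (X : int -> int -> int -> V -> V) w :
  iter k (mul3 0 1) (fun p r s => X r p s w)
  = (fun p r s => iter k (@mul_zw V) (X r) p s w).
Proof. by elim: k => //= k ->; apply: funext3 => p r s; rewrite /mul3 addr0. Qed.

(** Multiplication by z0 - z1 or z0 - z2 commutes with multiplication by an expanded power of z1 +
    eps z2. Truncation is carried along because [binexpB] needs it at every step. *)
Lemma iter_binexp_mul3 k eps t x y T : (forall p, trunc2 (T p)) ->
  iter k (mul3 x y) (fun p => binexp eps t (T p))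
    = (fun p => binexp eps t (iter k (mul3 x y) T p))
  /\ forall p, trunc2 (iter k (mul3 x y) T p).
Proof.
move=> T0; elim: k => //= k [-> Tk0]; split.
  apply: funext3 => p r s; rewrite /mul3 -binexp_shift -binexpB //.
  have [N N0] := Tk0 p; exists (N - y) => m n le_n; apply: N0; lia.
move=> p; have [N N0] := Tk0 (p + 1); have [N' N'0] := Tk0 p.
exists (`|N| + `|N'| + `|y|)%N => m n le_n.
by rewrite /mul3 N0 ?N'0 ?subrr //; lia.
Qed.

(** The coefficients of [c(z0), a(z1) b(z2)] applied to [w]. *)
Definition bracket3 c a b w p m n : V :=
  c p (a m (b n w)) - a m (b n (c p w)).

Lemma trunc2_bracket3 c a b w p : trunc2 (bracket3 c a b w p).
Proof.
have [N N0] := trunc2_modes a b w; have [M M0] := trunc2_modes a b (c p w).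
exists (Num.max N M) => m n; rewrite ge_max => /andP[/N0 Hn /M0 Hm].
by rewrite /bracket3 Hn Hm raddf0 subrr.
Qed.

(** Leibniz rule: [c, ab] = [c, a] b + a [c, b], where (z0 - z1)^k1 kills the first summand and (z0
    - z2)^k2 the second. *)
Lemma iter_bracket3 c a b k1 k2 w :
    (forall m n x, iter k1 (@mul_zw V) (series_comm c a) m n x = 0) ->
    (forall m n x, iter k2 (@mul_zw V) (series_comm c b) m n x = 0) ->
  iter k1 (mul3 1 0) (iter k2 (mul3 0 1) (bracket3 c a b w))
  = (fun _ _ _ => 0).
Proof.
move=> ca0 cb0.
have -> : bracket3 c a b w = (fun p m n =>
    series_comm c a p m (b n w) + a m (series_comm c b p n w) *~ 1).
  apply: funext3 => p m n.
  by rewrite mulr1z /bracket3 /series_comm raddfB addrA subrK.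
rewrite !iter_mul3D iter_mul3C iter_mul3_10 iter_mul3_01.
rewrite (_ : (fun p r s => iter k1 _ _ p r (b s w)) = fun _ _ _ => 0); last first.
  by apply: funext3 => *; rewrite ca0.
rewrite (_ : (fun p r s => a r _) = fun _ _ _ => 0); last first.
  by apply: funext3 => *; rewrite cb0 raddf0.
by rewrite !iter_mul3_0; apply: funext3 => *; rewrite addr0.
Qed.

(** The index [r] stays free, although the residue product only has [r = 0]: multiplication by z0 -
    z1 shifts it. *)
Definition comm_resprod c a b t w p r s : V :=
  c p (resprod a b t r s w) - resprod a b t r s (c p w).

Lemma comm_resprodE c a b t w :
  comm_resprod c a b t w = (fun p r s =>
    binexp (-1) t (bracket3 c a b w p) r s
    + binexp (-1) t (bracket3 c b a w p) s r *~ - (-1) ^ t).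
Proof.
apply: funext3 => p r s; rewrite /comm_resprod /resprod /bracket3.
have T1 a' b' : trunc2 (fun m n => c p (a' m (b' n w))).
  by apply: (@trunc2_field b' (fun m x => c p (a' m x))) => m; rewrite !raddf0.
rewrite (raddfB (c p)) raddfMz !binexp_raddf // !binexpB //.
rewrite mulrNz mulrzBl !opprB.
by rewrite (AC (2*2) ((1*4)*(3*2))).
Qed.

Lemma iter_comm_resprod c a b k1 k2 t w :
    (forall m n x, iter k1 (@mul_zw V) (series_comm c a) m n x = 0) ->
    (forall m n x, iter k2 (@mul_zw V) (series_comm c b) m n x = 0) ->
  iter k1 (mul3 1 0) (iter k2 (mul3 0 1) (comm_resprod c a b t w))
  = (fun _ _ _ => 0).
Proof.
move=> ca0 cb0.
have vanish a' b' j1 j2 :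
    (forall m n x, iter j1 (@mul_zw V) (series_comm c a') m n x = 0) ->
    (forall m n x, iter j2 (@mul_zw V) (series_comm c b') m n x = 0) ->
  iter j1 (mul3 1 0) (iter j2 (mul3 0 1)
    (fun p => binexp (-1) t (bracket3 c a' b' w p))) = (fun _ _ _ => 0).
  move=> ca0' cb0'.
  have [-> T0] := iter_binexp_mul3 j2 (-1) t 0 1 (trunc2_bracket3 c a' b' w).
  have [-> _] := iter_binexp_mul3 j1 (-1) t 1 0 T0.
  by rewrite iter_bracket3 //; apply: funext3 => *; rewrite binexp0.
rewrite comm_resprodE !iter_mul3D vanish //.
(* In the second summand z1 and z2 trade places, hence so do the factors z0 - z1 and z0 - z2. *)
pose U p r s := binexp (-1) t (bracket3 c b a w p) r s.
rewrite (iter_mul3_swap _ _ _ U) (iter_mul3_swap _ _ _ (iter k2 (mul3 1 0) U)).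
by rewrite iter_mul3C vanish //; apply: funext3 => *; rewrite mul0rz addr0.
Qed.

Lemma mul3_comm_resprod c a b t w :
  mul3 0 1 (comm_resprod c a b t w)
  = (fun p r s => mul3 1 0 (comm_resprod c a b t w) p r s
                  + comm_resprod c a b (t + 1) w p r s *~ 1).
Proof.
apply: funext3 => p r s; rewrite /mul3 /comm_resprod !addr0 !resprodS.
rewrite mulr1z (raddfB (c p) (resprod a b t (r + 1) s w)); move: (c (p + 1) _ - _) => A.
have E (x1 x2 y1 y2 : V) : x1 - x2 - (y1 - y2) = (x1 - y1) - (x2 - y2).
  by rewrite !opprB (AC (2*2) ((1*4)*(3*2))).
by rewrite E [RHS]addrA subrK.
Qed.

(* Dong's lemma. As z0 - z2 = (z0 - z1) + (z1 - z2) and multiplying by z1 - z2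
   raises t by one, powers of z0 - z1 are traded for larger values of t,
   where [resprod_vanish] applies. *)
Lemma local_resprod c a b t :
    mutually_local c a -> mutually_local c b -> mutually_local a b ->
  exists N : nat, forall r p s w,
    iter N (@mul_zw V)
      (fun p s w => c p (resprod a b t r s w) - resprod a b t r s (c p w)) p s w
    = 0.
Proof.
move=> [k1 ca0] [k2 cb0] /resprod_vanish[t0 ab0].
(* Nested induction: [d] bounds how far [t] is below [t0], and [e] below bounds how many factors z0
   - z1 are missing from [k1]. *)
suff H d j : t0%:Z - t <= d%:Z -> exists N : nat, forall w,
    iter N (mul3 0 1) (iter j (mul3 1 0) (comm_resprod c a b t w))
    = (fun _ _ _ => 0).
  have [|N N0] := H `|t0%:Z - t|%N 0%N; first lia.
  exists N => r p s w; have := congr1 (fun T => T p r s) (N0 w).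
  by rewrite /= (iter_mul3_param N (fun r p s w => comm_resprod c a b t w p r s)).
elim: d t j => [|d IHd] t j le_t.
  exists 0%N => w /=; rewrite (_ : comm_resprod _ _ _ _ _ = fun _ _ _ => 0).
    exact: iter_mul3_0.
  have t_ge : t0%:Z <= t by lia.
  by apply: funext3 => *; rewrite /comm_resprod !ab0 // raddf0 subrr.
have [e] : exists e, (k1 <= j + e)%N by exists k1; apply: leq_addl.
elim: e j => [|e IHe] j le_j.
  rewrite addn0 in le_j.
  exists k2 => w; rewrite iter_mul3C -(subnK le_j) iterD.
  by rewrite (iter_comm_resprod _ _ ca0 cb0) iter_mul3_0.
have [|N N0] := IHe j.+1; first by rewrite addSnnS.
have [|M M0] := IHd (t + 1) j; first lia.
(* The extra factor z0 - z2 is split: one part raises [j] and is killed by [N], the other raises [t]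
   and is killed by [M]. *)
exists (maxn N M).+1 => w; rewrite iterSr.
rewrite [mul3 0 1 _](iter_mul3C 1 j) /= mul3_comm_resprod !iter_mul3D -iterSr.
have vanish K T : (K <= maxn N M)%N ->
    iter K (mul3 0 1) T = (fun _ _ _ => 0) ->
  iter (maxn N M) (mul3 0 1) T = (fun _ _ _ => 0).
  by move=> le_K T0; rewrite -(subnK le_K) iterD T0 iter_mul3_0.
rewrite (vanish N) ?leq_maxl ?N0 // (vanish M) ?leq_maxr ?M0 //.
by apply: funext3 => *; rewrite mul0rz addr0.
Qed.

End Residues.

(** * Goddard's uniqueness theorem *)

Section LocalSeries.
Variable V : zmodType.
Implicit Types (X Z : int -> int -> V -> V) (c : int -> V -> V).

Lemma iter_mul_zwB k X Z m n x :
  iter k (@mul_zw V) (fun m n x => X m n x - Z m n x) m n x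
  = iter k (@mul_zw V) X m n x - iter k (@mul_zw V) Z m n x.
Proof.
elim: k m n => //= k IHk m n.
by rewrite /mul_zw !IHk !opprB (AC (2*2) ((1*4)*(3*2))).
Qed.

(** Any factor z raises the first index from -1 into the range where [X] vanishes, so only (-w)^k
    contributes. *)
Lemma iter_mul_zwN1 k X n x :
    (forall m n, 0 <= m -> X m n x = 0) ->
  iter k (@mul_zw V) X (-1) n x = X (-1) (n + k%:Z) x *~ (-1) ^+ k.
Proof.
move=> X0.
have Xk j m n' : 0 <= m -> iter j (@mul_zw V) X m n' x = 0.
  elim: j m n' => [|j IHj] m n' m0 /=; first exact: X0.
  by rewrite /mul_zw !IHj ?subrr //; lia.
elim: k n => [|k IHk] n; first by rewrite addr0 mulr1z.
rewrite /= {1}/mul_zw Xk // IHk sub0r exprS mulN1r mulrNz.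
by congr (- (X _ _ _ *~ _)); lia.
Qed.

(* Goddard's uniqueness theorem: locality moves d next to the vacuum, where it
   vanishes, and taking w = 0 in Y(v, w) v0 leaves z^t d(z) v = 0. *)
Lemma goddard (v0 : V) (Y : V -> field_on V) (d e : int -> V -> V) :
    (forall u, Y u (-1) v0 = u /\ forall n, 0 <= n -> Y u n v0 = 0) ->
    (forall n, d n 0 = 0) -> (forall n, e n 0 = 0) ->
    (forall n, d n v0 = e n v0) ->
    (forall u, exists k, forall m n x, iter k (@mul_zw V)
       (fun m n x => Y u m (d n x) - d n (Y u m x)) m n x = 0) ->
    (forall u, exists k, forall m n x, iter k (@mul_zw V)
       (fun m n x => Y u m (e n x) - e n (Y u m x)) m n x = 0) ->
  forall n x, d n x = e n x.
Proof.
move=> Yv0 d0 e0 de_v0 locd loce n x.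
have [k dk0] := locd x; have [l el0] := loce x.
have persist (X : int -> int -> V -> V) K :
    (forall m n x, iter K (@mul_zw V) X m n x = 0) -> (K <= maxn k l)%N ->
  forall m n x, iter (maxn k l) (@mul_zw V) X m n x = 0.
  move=> X0 le_K; rewrite -(subnK le_K) iterD.
  elim: (_ - _)%N => [|j IHj] m n' y /=; first exact: X0.
  by rewrite /mul_zw !IHj subrr.
pose X m n' y := (Y x m (d n' y) - d n' (Y x m y)) - (Y x m (e n' y) - e n' (Y x m y)).
(* The second index is lowered by the exponent so that multiplication by the power of w brings it
   back to [n]. *)
have X0 : iter (maxn k l) (@mul_zw V) X (-1) (n - (maxn k l)%:Z) v0 = 0.
  rewrite iter_mul_zwB (persist _ k) ?leq_maxl // (persist _ l) ?leq_maxr //.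
  exact: subrr.
have [xv0 x0] := Yv0 x.
move: X0; rewrite iter_mul_zwN1 => [|m n' m0].
  rewrite subrK /X de_v0 xv0 opprB addrC addrA subrK.
  move/(congr1 (fun y => y *~ (-1) ^+ maxn k l)).
  rewrite -mulrzA -expr2 sqrr_sign mulr1z mul0rz => /eqP.
  by rewrite subr_eq0 => /eqP.
by rewrite /X de_v0 x0 // d0 e0 subrr.
Qed.

End LocalSeries.

(** For positive [r] the recursion climbs from [r = 0]. For negative [r], once [r + 1] is settled,
    the value at [(s + 1, t)] is minus that at [(s, t + 1)], so [t] can be raised to [t0]. *)
Lemma borcherds_induction (V : zmodType) (X : int -> int -> int -> V) (t0 : int) :
    (forall r s t, X (r + 1) s t = X r (s + 1) t + X r s (t + 1)) ->
    (forall s t, X 0 s t = 0) ->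
    (forall r s t, t0 <= t -> X r s t = 0) ->
  forall r s t, X r s t = 0.
Proof.
move=> Xrec X0 Xt0 r; elim/int_rec: r => // n IHn s t.
  by rewrite -addn1 PoszD Xrec !IHn addr0.
have down s' t' : X (- n.+1%:Z) (s' + 1) t' = - X (- n.+1%:Z) s' (t' + 1).
  apply/eqP; rewrite -addr_eq0 -Xrec (_ : _ + 1 = - n%:Z) ?IHn //; lia.
have [d] : exists d : nat, t0 - t <= d%:Z by exists `|t0 - t|%N; lia.
elim: d s t => [|d IHd] s t le_t; first by apply: Xt0; lia.
by rewrite -(subrK 1 s) down IHd ?oppr0 //; lia.
Qed.

(** * Reconstruction of the vertex ring *)

Section Reconstruction.
Variables (V : zmodType) (v0 : V) (D : nat -> {additive V -> V}).
Variable Y : V -> field_on V.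
Hypothesis D_id : forall x : V, D 0%N x = x.
Hypothesis D_v0 : forall m : nat, (1 <= m)%N -> D m v0 = 0.
Hypothesis Y_add : forall (u v : V) (n : int) (x : V),
  Y (u + v) n x = Y u n x + Y v n x.
Hypothesis Y_local : forall u v : V, mutually_local (Y u) (Y v).
Hypothesis Y_creative : forall u : V,
  Y u (-1) v0 = u /\ forall n : int, 0 <= n -> Y u n v0 = 0.
Hypothesis Y_covariant : forall (u : V) (m : nat) (n : int) (x : V),
  D m (Y u n x) - Y u n (D m x)
  = \sum_(1 <= i < m.+1) hasse_deriv i (Y u) n (D (m - i)%N x).

Lemma Y_vac u : Y u (-1) v0 = u. Proof. by case: (Y_creative u). Qed.

Lemma Y_vac_ge0 u n : 0 <= n -> Y u n v0 = 0.
Proof. by case: (Y_creative u) => _; apply. Qed.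

(** Covariance solved for [D m (Y u n x)]; the term [Y u n (D m x)] becomes the summand [i = 0]. *)
Lemma D_mode u m n x :
  D m (Y u n x) = \sum_(i < m.+1) Y u (n - i%:Z) (D (m - i)%N x)
                                  *~ ((-1) ^+ i * binz n i).
Proof.
rewrite -[LHS](subrK (Y u n (D m x))) Y_covariant addrC big_add1 /= big_mkord.
rewrite big_ord_recl binz0 expr0 mulr1z subr0 subn0; congr (_ + _).
apply: eq_bigr => i _; rewrite /hasse_deriv lift0 -binz_neg.
by congr (_ *~ binz _ _); lia.
Qed.

(** In [D_mode] at [n = -1] on [v0], only [i = m] survives since the other [D (m - i)] kill [v0];
    its coefficient is 1. *)
Lemma D_vac u m : Y u (- m%:Z - 1) v0 = D m u.
Proof.
rewrite -[in RHS](Y_vac u) D_mode big_ord_recr /= big1 ?add0r => [|i _].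
  rewrite subnn D_id -binz_neg (_ : m%:Z - -1 - 1 = m) ?binznn ?mulr1z; last lia.
  by rewrite addrC.
by rewrite D_v0 ?subn_gt0 ?ltn_ord // raddf0 mul0rz.
Qed.

(** The second expansion involves only nonnegative modes of [Y u] on [v0], hence vanishes. For
    [s < 0] the right side is a [D m (Y u t v)], which [D_mode] expands into the first. *)
Lemma resprod_vac u v t s :
  resprod (Y u) (Y v) t 0 s v0 = Y (Y u t v) s v0.
Proof.
rewrite /resprod [X in _ - X *~ _]binexp0 => [|m n n0]; last first.
  by rewrite Y_vac_ge0 ?raddf0.
rewrite mul0rz subr0; case: (leP 0 s) => [s0|s_lt0].
  rewrite binexp0 ?Y_vac_ge0 // => m n le_n.
  by rewrite Y_vac_ge0 ?raddf0 //; lia.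
have -> : s = - (`|s|.-1)%:Z - 1 by lia.
move: `|s|%N.-1 => m; rewrite D_vac D_mode /binexp (fsumE (N := m.+1)).
  apply: eq_bigr => i _; rewrite /binexp_term add0r -D_vac.
  by congr (Y u _ (Y v _ _) *~ _); have := ltn_ord i; lia.
by move=> i le_i; rewrite /binexp_term Y_vac_ge0 ?raddf0 ?mul0rz //; lia.
Qed.

Lemma mode_product u v t s w :
  Y (Y u t v) s w = resprod (Y u) (Y v) t 0 s w.
Proof.
apply/esym.
apply: (goddard (v0 := v0) (Y := Y) (e := fun n x => Y (Y u t v) n x)).
- exact: Y_creative.
- by move=> n; apply: resprodx0.
- by move=> n; apply: raddf0.
- exact: resprod_vac.
- move=> x; have [N N0] := local_resprod t (Y_local x u) (Y_local x v) (Y_local u v).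
  by exists N; apply: N0.
- by move=> x; apply: Y_local.
Qed.

Lemma Y0 n x : Y 0 n x = 0.
Proof. by apply: (addrI (Y 0 n x)); rewrite -Y_add !addr0. Qed.

Lemma trunc2_iterate u v w : trunc2 (fun q p => Y (Y u p v) q w).
Proof. by have [N N0] := mode_field (Y u) v; exists N => m n /N0->; apply: Y0. Qed.

(** The left side is z^r Y(Y(u, z - w)v, w) with z^r = (w + (z - w))^r expanded in nonnegative
    powers of z - w, so [binexpS] gives its recursion. *)
Lemma borcherds u v w r s t :
  binexp 1 r (fun q p => Y (Y u p v) q w) s t = resprod (Y u) (Y v) t r s w.
Proof.
have T0 := trunc2_iterate u v w.
have [N N0] := mode_field (Y u) v; have [M M0] := resprod_vanish (Y_local u v).
apply/eqP; rewrite -subr_eq0; apply/eqP; move: r s t.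
(* Beyond [N] the products [Y u t v] vanish, and beyond [M] locality kills the right side. *)
apply: (borcherds_induction (t0 := Num.max N M%:Z)) => [r s t|s t|r s t].
- rewrite binexpS // mulr1z resprodS.
  by rewrite opprB [RHS]addrACA addKr.
- by rewrite binexp_t0 mode_product subrr.
- rewrite ge_max => /andP[le_N le_M]; rewrite M0 // binexp0 ?subrr // => m n le_n.
  by rewrite N0 ?Y0 //; apply: le_trans le_n.
Qed.

End Reconstruction.

Theorem theorem4p3 (V : zmodType) (v0 : V) (D : nat -> {additive V -> V})
    (Y : V -> field_on V)
    (D_id : forall x : V, D 0%N x = x)
    (D_v0 : forall m : nat, (1 <= m)%N -> D m v0 = 0)
    (Y_add : forall (u v : V) (n : int) (x : V),
       Y (u + v) n x = Y u n x + Y v n x)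
    (Y_local : forall u v : V, mutually_local (Y u) (Y v))
    (Y_creative : forall u : V,
       Y u (-1) v0 = u /\ forall n : int, 0 <= n -> Y u n v0 = 0)
    (Y_covariant : forall (u : V) (m : nat) (n : int) (x : V),
       D m (Y u n x) - Y u n (D m x)
       = \sum_(1 <= i < m.+1) hasse_deriv i (Y u) n (D (m - i)%N x)) :
  exists R : vertex_ring V,
    [/\ forall (u v : V) (n : int), vprod R u n v = Y u n v,
        forall (u : V) (n : int), state_field R u n =1 Y u n,
        vacuum R = v0
      & forall m : nat, canonical_hasse R m =1 D m].
Proof.
have trunc u v : exists n0 : nat, forall n : int, n0%:Z <= n -> Y u n v = 0.
  by have [N N0] := mode_field (Y u) v; exists `|N|%N => n ?; apply: N0; lia.
have jacobi u v w (r s t : int) : exists2 x : V,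
    is_finsum (fun i : nat =>
      Y (Y u (t + i%:Z) v) (r + s - i%:Z) w *~ binz r i) x
  & is_finsum (fun i : nat =>
      (Y u (r + t - i%:Z) (Y v (s + i%:Z) w)
       - Y v (s + t - i%:Z) (Y u (r + i%:Z) w) *~ (-1) ^ t)
      *~ ((-1) ^+ i * binz t i)) x.
  exists (resprod (Y u) (Y v) t r s w); last exact: is_finsum_resprod.
  rewrite -(borcherds D_id D_v0 Y_add Y_local Y_creative Y_covariant).
  have := is_finsum_binexp 1 r s t (trunc2_iterate Y_add u v w).
  congr is_finsum; apply/funext => i.
  by rewrite /binexp_term expr1n mul1r (addrC s).
exists (@VertexRing V (fun u n v => Y u n v) v0
  (fun n u u' v => Y_add u u' n v) (fun n u => raddfD (Y u n)) trunc
  (fun u => proj1 (Y_creative u)) (fun u => proj2 (Y_creative u)) jacobi).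
split=> // m u; exact: D_vac D_id D_v0 Y_creative Y_covariant u m.
Qed.
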